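(* Let $F$ be a graph and let $e$ be any edge of $F$. Then $\mathrm{th}(F)\le R(K_{\chi(F)},F\setminus e)$.
   Context: A hypergraph $\mathcal{H}$ is a Berge copy of a graph $G$ (Berge-$G$) if $V(G)\subseteq V(\mathcal{H})$ and there is a bijection $f:E(G)\to E(\mathcal{H})$ with $e\subseteq f(e)$ for every $e\in E(G)$; $G$ is then called the core. $\mathrm{ex}_r(n,\text{Berge-}F)$ denotes the maximum number of hyperedges in an $r$-uniform $n$-vertex hypergraph containing no Berge copy of $F$. It is known that for every graph $F$ there is an integer $r_0$ such that $\mathrm{ex}_r(n,\text{Berge-}F)=o(n^2)$ (as $n\to\infty$) for every $r\ge r_0$; the uniformity threshold $\mathrm{th}(F)$ is the smallest such $r_0$. $\chi(F)$ is the chromatic number, $F\setminus e$ is the graph obtained from $F$ by deleting the edge $e$, and $R(H,G)$ is the off-diagonal Ramsey number: the smallest $N$ such that every red/blue coloring of the edges of $K_N$ contains a blue copy of $H$ or a red copy of $G$. *)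

(* Defs.v *)
From mathcomp Require Import all_boot.
Set Implicit Arguments. Unset Strict Implicit. Unset Printing Implicit Defensive.

Definition simple_graph (V : finType) (E : {set {set V}}) : Prop :=
  forall e, e \in E -> #|e| = 2.

Definition proper_colouring (V : finType) (E : {set {set V}}) (k : nat)
    (c : V -> 'I_k) : bool :=
  [forall e in E, forall x in e, forall y in e, (x != y) ==> (c x != c y)].

Definition colourable (V : finType) (E : {set {set V}}) (k : nat) : bool :=
  [exists c : {ffun V -> 'I_k}, proper_colouring E c].

Lemma colourable_card (V : finType) (E : {set {set V}}) :
  exists k, colourable E k.
Proof.
exists #|V|; apply/existsP; exists [ffun x => enum_rank x].
apply/forallP=> e; apply/implyP=> _; apply/forallP=> x; apply/implyP=> _.
apply/forallP=> y; apply/implyP=> _; apply/implyP=> nxy.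
by rewrite !ffunE; apply: contra nxy => /eqP /enum_rank_inj ->.
Qed.

Definition chromatic_number (V : finType) (E : {set {set V}}) : nat :=
  ex_minn (colourable_card E).

(* A red/blue colouring of the edges of K_N: c [set i; j] = true means red,
   false means blue (values on sets that are not 2-sets are irrelevant). *)
Definition blue_clique (N k : nat) (c : {set 'I_N} -> bool) : Prop :=
  exists phi : 'I_k -> 'I_N, injective phi /\
    forall i j : 'I_k, i != j -> c [set phi i; phi j] = false.

Definition red_copy (N : nat) (W : finType) (G : {set {set W}})
    (c : {set 'I_N} -> bool) : Prop :=
  exists phi : W -> 'I_N, injective phi /\
    forall e, e \in G -> c (phi @: e) = true.

Definition ramsey_property (k : nat) (W : finType) (G : {set {set W}})
    (N : nat) : Prop :=
  forall c : {set 'I_N} -> bool, blue_clique k c \/ red_copy G c.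

Definition is_ramsey_number (k : nat) (W : finType) (G : {set {set W}})
    (N : nat) : Prop :=
  ramsey_property k G N /\ forall M, ramsey_property k G M -> N <= M.

Definition uniform (n r : nat) (H : {set {set 'I_n}}) : bool :=
  [forall h in H, #|h| == r].

Definition contains_berge (V : finType) (E : {set {set V}}) (n : nat)
    (H : {set {set 'I_n}}) : bool :=
  [exists phi : {ffun V -> 'I_n}, injectiveb phi &&
    [exists f : {ffun {set V} -> {set 'I_n}},
      [forall e in E, (f e \in H) && (phi @: e \subset f e)] &&
      [forall e1 in E, forall e2 in E, (f e1 == f e2) ==> (e1 == e2)]]].

Definition ex_berge (V : finType) (E : {set {set V}}) (r n : nat) : nat :=
  \max_(H : {set {set 'I_n}} | uniform r H && ~~ contains_berge E H) #|H|.

Definition ex_berge_subquadratic (V : finType) (E : {set {set V}}) (r : nat)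
    : Prop :=
  forall k : nat, 0 < k -> exists N : nat, forall n : nat, N <= n ->
    k * ex_berge E r n <= n ^ 2.

(* r0 is admissible for the uniformity threshold: ex_r = o(n^2) for all r >= r0.
   th(F) is the least admissible r0, so th(F) <= m iff m is admissible. *)
Definition threshold_admissible (V : finType) (E : {set {set V}}) (r0 : nat)
    : Prop :=
  forall r, r0 <= r -> ex_berge_subquadratic E r.

(* Main.v *)
Require Import Defs.
From mathcomp Require Import all_boot all_order all_algebra.
From mathcomp Require Import zify lra.
Set Implicit Arguments. Unset Strict Implicit. Unset Printing Implicit Defensive.
Import Order.TTheory GRing.Theory Num.Theory.

(** Colour a pair inside a hyperedge red if it lies in at least |E(F)| hyperedges.
    A red copy of F \ e inside a hyperedge h extends greedily to a Berge-F in
    which e is represented by h. So in a Berge-F-free hypergraph every hyperedge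
    of size at least R(K_chi, F \ e) contains a clique K_chi of pairs of bounded
    codegree, and a positive proportion of these cliques pairwise share at most
    one vertex. If there were more than eps n^2 of them, Szemerédi regularity of
    the union graph and the usual cleaning would leave a clique all of whose
    edges lie in dense regular pairs of large parts. F is embedded greedily into
    these parts along a proper chi-colouring; as two vertices lie in at most one
    clique, each new vertex can also avoid all cliques that already contain two
    embedded vertices. Then distinct edges of F lie in distinct cliques, hence
    in distinct hyperedges, which is a Berge-F. *)

(** * Systems of distinct representatives *)

(** Greedy choice: the representatives of the tail [s] take at most [size s] values, so the set of
    the head still has a free element. *)
Lemma distinct_representatives (X Y : finType) (y0 : Y) (s : seq X)
    (C : X -> {set Y}) :
  {in s, forall x, size s <= #|C x|} ->
  exists f : X -> Y, {in s, forall x, f x \in C x} /\ {in s &, injective f}.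
Proof.
elim: s => [|x s IHs] Cs; first by exists (fun=> y0).
have [|f [fC f_inj]] := IHs.
  by move=> u us; apply: ltnW; apply: Cs; rewrite inE us orbT.
have /subsetPn[y yC yNf] : ~~ (C x \subset [set y in map f s]).
  apply/negP=> /subset_leq_card; rewrite cardsE => /leq_trans/(_ (card_size _)).
  by rewrite size_map leqNgt (Cs x) ?mem_head.
have yNfs u : u \in s -> f u != y.
  by move=> us; apply: contra yNf => /eqP <-; rewrite inE map_f.
exists (fun u => if u == x then y else f u); split=> [u|u v].
  by rewrite inE; case: eqP => [-> //|_ /= /fC].
rewrite !inE; case: eqP => [->|_]; case: eqP => [->|_] //=.
- by move=> _ vs /esym/eqP; rewrite (negbTE (yNfs v vs)).
- by move=> us _ /eqP; rewrite (negbTE (yNfs u us)).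
exact: f_inj.
Qed.

(** * Averages over a partition and their energy *)

Section Average.
Local Open Scope ring_scope.
Variables (R : realFieldType) (U : finType).
Implicit Types (f g : U -> R) (W : {set U}).

(** The conditional expectation of [f] given the partition into fibres of [P]. *)
Definition avg (I : finType) (P : U -> I) f (u : U) : R :=
  (\sum_(v | P v == P u) f v) / #|[pred v | P v == P u]|%:R.

Definition energy (I : finType) (P : U -> I) f : R := \sum_u avg P f u ^+ 2.

Lemma avg_fiber (I : finType) (P : U -> I) f u v :
  P u = P v -> avg P f u = avg P f v.
Proof. by rewrite /avg => ->. Qed.

(** Averaging is the orthogonal projection onto functions constant on fibres: after exchanging sums,
    [v] contributes [f v * g v / n v] once for each of the [n v] members of its fibre. *)
Lemma sum_avg_mul (I : finType) (P : U -> I) f g :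
    (forall u v, P u = P v -> g u = g v) ->
  \sum_u avg P f u * g u = \sum_u f u * g u.
Proof.
move=> gP; pose n u : R := #|[pred v | P v == P u]|%:R.
have n_neq0 u : n u != 0.
  by rewrite pnatr_eq0 -lt0n; apply/card_gt0P; exists u; rewrite inE.
under eq_bigr => u _ do rewrite /avg !mulr_suml.
rewrite (exchange_big_dep predT) //=; apply: eq_bigr => v _.
rewrite (eq_bigr (fun=> f v * g v / n v)) => [|u /eqP Pvu]; last first.
  by rewrite /n Pvu (gP _ _ Pvu) mulrAC.
rewrite sumr_const -[X in _ *+ X]/(#|[pred u | P v == P u]|).
rewrite (@eq_card _ _ [pred u | P u == P v]) => [|u]; last first.
  by rewrite !inE eq_sym.
by rewrite -[_ *+ _]mulr_natr -/(n v) mulfVK.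
Qed.

Lemma energy_ge0 (I : finType) (P : U -> I) f : 0 <= energy P f.
Proof. by apply: sumr_ge0 => u _; apply: sqr_ge0. Qed.

Lemma energy_le (I : finType) (P : U -> I) f : energy P f <= \sum_u f u ^+ 2.
Proof.
have := @sum_avg_mul _ P f (avg P f) (@avg_fiber _ P f).
under eq_bigr => u _ do rewrite -expr2.
rewrite -/(energy P f) => fE.
have : 0 <= \sum_u (f u - avg P f u) ^+ 2 by apply: sumr_ge0 => u _; apply: sqr_ge0.
under eq_bigr => u _ do rewrite sqrrB.
rewrite big_split sumrB /= sumrMnl -fE -/(energy P f); lra.
Qed.

(* Pythagoras: the energy gained equals the squared distance between the two
   averages, which on [W] is bounded below by [x ^+ 2 >= 2 * t * x - t ^+ 2]. *)
Lemma energy_increment (I J : finType) (P : U -> I) (P' : U -> J) f W t :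
    (forall u v, P' u = P' v -> P u = P v) ->
    (forall u v, P' u = P' v -> (u \in W) = (v \in W)) ->
    0 <= t -> {in W, forall u, 2 * t <= avg P f u} ->
    \sum_(u in W) f u <= t * #|W|%:R ->
  energy P f + t ^+ 2 * #|W|%:R <= energy P' f.
Proof.
move=> PP' WP' t0 tW fW.
have aE : \sum_u avg P' f u * avg P f u = energy P f.
  rewrite sum_avg_mul => [|u v /PP' /avg_fiber //].
  rewrite -(@sum_avg_mul _ P) => [|u v /avg_fiber //].
  by apply: eq_bigr => u _; rewrite expr2.
have a'W : \sum_(u in W) avg P' f u = \sum_(u in W) f u.
  rewrite big_mkcond [RHS]big_mkcond /=.
  have := @sum_avg_mul _ P' f (fun u => (u \in W)%:R).
  move=> /(_ (fun u v P'uv => congr1 (fun b : bool => b%:R) (WP' u v P'uv))).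
  have E h : \sum_u h u * (u \in W)%:R = \sum_u if u \in W then h u else 0 :> R.
    by apply: eq_bigr => u _; case: (u \in W); rewrite ?mulr1 ?mulr0.
  by rewrite !E.
have aW : 2 * t * #|W|%:R <= \sum_(u in W) avg P f u.
  by rewrite mulr_natr -sumr_const; apply: ler_sum.
have : \sum_(u in W) (2 * t * (avg P f u - avg P' f u) - t ^+ 2)
      <= \sum_u (avg P' f u - avg P f u) ^+ 2.
  rewrite big_mkcond; apply: ler_sum => u _.
  case: ifP => _; last exact: sqr_ge0.
  have := sqr_ge0 (avg P' f u - avg P f u + t); nra.
rewrite sumrB -mulr_sumr sumrB sumr_const a'W -[_ *+ #|_|]mulr_natr.
under [leRHS]eq_bigr => u _ do rewrite sqrrB.
rewrite big_split sumrB /= sumrMnl aE -!/(energy _ f).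
have := ler0n R #|W|; move: aW fW t0.
set n := #|W|%:R; set s := \sum_(u in W) _; set s' := \sum_(u in W) _.
move=> aW fW t0 n0.
have : 2 * t * (t * n) <= 2 * t * (s - s') by apply: ler_wpM2l; lra.
lra.
Qed.

End Average.

(** * A regularity lemma for pairs of positive density *)

Section Regularity.
Variables (T : finType) (G : rel T).
Implicit Types (A B X Y : {set T}).

Definition edges X Y : nat := \sum_(x in X) \sum_(y in Y) G x y.

(* Only pairs of density at least [1/g] matter, and for these a subpair of
   relative size at least [1/h] must not fall below half of that density. *)
Definition irregular g h A B : bool :=
  (#|A| * #|B| <= g * edges A B) &&
  [exists X : {set T}, exists Y : {set T},
    [&& X \subset A, Y \subset B, #|A| <= h * #|X|, #|B| <= h * #|Y|
      & 2 * g * edges X Y < #|X| * #|Y|]].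

Definition part (K : finType) (p : T -> K) a : {set T} := [set x | p x == a].

(** Pairs of vertices rather than of parts, so that parts of unequal size are weighted by their
    sizes. *)
Definition irregular_pairs g h (K : finType) (p : T -> K) : {set T * T} :=
  [set xy | irregular g h (part p (p xy.1)) (part p (p xy.2))].

Lemma sum_over_cells (K : finType) (p : T -> K) (D : rel K)
    (X : K -> K -> {set T}) (Y : K -> K -> {set T}) (F : T * T -> nat) :
    (forall a b, D a b -> X a b \subset part p a) ->
    (forall a b, D a b -> Y a b \subset part p b) ->
  \sum_(u : T * T | [&& D (p u.1) (p u.2), u.1 \in X (p u.1) (p u.2)
                      & u.2 \in Y (p u.1) (p u.2)]) F u =
  \sum_(ab : K * K | D ab.1 ab.2)
     \sum_(x in X ab.1 ab.2) \sum_(y in Y ab.1 ab.2) F (x, y).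
Proof.
move=> Xp Yp.
rewrite (partition_big (fun u => (p u.1, p u.2)) (fun ab => D ab.1 ab.2)) /=;
  last by move=> u /and3P[].
apply: eq_bigr => -[a b] /= Dab; rewrite pair_big; apply: eq_big => [[x y]|[x y] //] /=.
apply/andP/andP => [[/and3P[_ xX yY] /eqP[<- <-]] //|[xX yY]].
have /eqP pxa : p x == a by have := subsetP (Xp _ _ Dab) _ xX; rewrite inE.
have /eqP pyb : p y == b by have := subsetP (Yp _ _ Dab) _ yY; rewrite inE.
by rewrite pxa pyb Dab xX yY.
Qed.

Definition indic (R : pzSemiRingType) (u : T * T) : R := (G u.1 u.2)%:R%R.

Lemma avg_indic (R : realFieldType) (K : finType) (p : T -> K) u :
  (avg (fun v => (p v.1, p v.2)) (@indic R) u =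
  (edges (part p (p u.1)) (part p (p u.2)))%:R /
    (#|part p (p u.1)| * #|part p (p u.2)|)%:R)%R.
Proof.
rewrite /avg; congr (_ / _%:R)%R; last first.
  rewrite -cardsX; apply: eq_card => -[x y].
  by rewrite !inE /= -pair_eqE.
rewrite /edges natr_sum; under [RHS]eq_bigr => x _ do rewrite natr_sum.
by rewrite pair_big; apply: eq_bigl => -[x y]; rewrite !inE.
Qed.

(** [W] collects the witness rectangles of all irregular pairs of parts. On [W] the old average is
    at least [1/g] but the true density is at most [1/(2g)], so the energy increment applies with
    [t = 1/(2g)]. *)
Lemma refine_irregular (R : realFieldType) g h z (K : finType) (p : T -> K) :
    0 < g -> 0 < h -> 0 < z -> #|T| ^ 2 < z * #|irregular_pairs g h p| ->
  exists p' : T -> K * {ffun K * K -> bool * bool},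
    (energy (fun v => (p v.1, p v.2)) (@indic R)
       + ((2 * g)%:R ^- 2 / (h ^ 2 * z)%:R) * (#|T| ^ 2)%:R
     <= energy (fun v => (p' v.1, p' v.2)) (@indic R))%R.
Proof.
move=> g0 h0 z0 irrT.
pose D a b := irregular g h (part p a) (part p b).
have /fin_all_exists[XY XYP] (ab : K * K) : exists XY : {set T} * {set T},
    D ab.1 ab.2 -> [/\ XY.1 \subset part p ab.1, XY.2 \subset part p ab.2,
      #|part p ab.1| <= h * #|XY.1|, #|part p ab.2| <= h * #|XY.2|
      & 2 * g * edges XY.1 XY.2 < #|XY.1| * #|XY.2| ].
  case Dab: (D ab.1 ab.2); last by exists (set0, set0).
  by case/andP: Dab => _ /existsP[X /existsP[Y /and5P[]]]; exists (X, Y).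
pose X a b := (XY (a, b)).1; pose Y a b := (XY (a, b)).2.
pose inW u := [&& D (p u.1) (p u.2), u.1 \in X (p u.1) (p u.2)
                      & u.2 \in Y (p u.1) (p u.2)].
pose W := [set u | inW u].
have Xp a b : D a b -> X a b \subset part p a by move/(XYP (a, b)) => [].
have Yp a b : D a b -> Y a b \subset part p b by move/(XYP (a, b)) => [].
(* Recording which witness sets contain [x] makes [W] a union of cells of the new partition. *)
exists (fun x => (p x, [ffun ab => (x \in (XY ab).1, x \in (XY ab).2)])).
have cardW : #|W| = \sum_(ab : K * K | D ab.1 ab.2) #|X ab.1 ab.2| * #|Y ab.1 ab.2|.
  rewrite -sum1_card; under eq_bigl => u do rewrite inE.
  rewrite (sum_over_cells (fun=> 1)) //; apply: eq_bigr => ab _.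
  by rewrite sum_nat_const sum1_card.
have cardI : #|irregular_pairs g h p|
    = \sum_(ab : K * K | D ab.1 ab.2) #|part p ab.1| * #|part p ab.2|.
  transitivity (\sum_(u : T * T | [&& D (p u.1) (p u.2),
       u.1 \in part p (p u.1) & u.2 \in part p (p u.2)]) 1).
    rewrite -sum1_card; apply: eq_bigl => u.
    by rewrite !inE !eqxx !andbT.
  rewrite (sum_over_cells (X := fun a b => part p a) (Y := fun a b => part p b)) //.
  by apply: eq_bigr => ab _; rewrite sum_nat_const sum1_card.
have IW : #|irregular_pairs g h p| <= h ^ 2 * #|W|.
  rewrite cardI cardW big_distrr; apply: leq_sum => -[a b] /(XYP (a, b)) /= [_ _ hA hB _].
  by rewrite -mulnn mulnACA; apply: leq_mul.
have edgesW : 2 * g * \sum_(u in W) G u.1 u.2 <= #|W|.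
  under eq_bigl => u do rewrite inE.
  rewrite cardW (sum_over_cells (fun u => G u.1 u.2)) //= big_distrr.
  by apply: leq_sum => -[a b] /(XYP (a, b)) /= [_ _ _ _ /ltnW].
have gR : (0 < (2 * g)%:R :> R)%R by rewrite ltr0n muln_gt0.
apply: le_trans (@energy_increment R _ _ _ (fun v => (p v.1, p v.2)) _ _ W
    ((2 * g)%:R^-1)%R _ _ _ _ _).
- rewrite lerD2l exprVn -mulrA; apply: ler_wpM2l.
    by rewrite invr_ge0 exprn_ge0 ?ltW.
  rewrite mulrC ler_pdivrMr ?ltr0n ?muln_gt0 ?expn_gt0 ?h0 //.
  rewrite -natrM ler_nat; apply: leq_trans (ltnW irrT) _.
  by move: (leq_mul (leqnn z) IW); move: (h ^ 2) => h2; lia.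
- by move=> u v [-> _ -> _].
- move=> u v [p1 /ffunP e1 p2 /ffunP e2].
  rewrite !inE /inW p1 p2; congr [&& _, _ & _].
    by have := e1 (p v.1, p v.2); rewrite !ffunE => -[].
  by have := e2 (p v.1, p v.2); rewrite !ffunE => -[].
- by rewrite invr_ge0 ltW.
- move=> u; rewrite inE avg_indic => /and3P[/andP[dense _] _ _].
  have c0 : 0 < #|part p (p u.1)| * #|part p (p u.2)|.
    by rewrite muln_gt0; apply/andP; split; apply/card_gt0P;
      [exists u.1|exists u.2]; rewrite inE.
  have -> : (2 * (2 * g)%:R^-1 = g%:R^-1 :> R)%R by rewrite natrM invfM mulVKf ?pnatr_eq0.
  rewrite ler_pdivlMr ?ltr0n // mulrC ler_pdivrMr ?ltr0n // -natrM ler_nat [leqRHS]mulnC //.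
- rewrite /indic -natr_sum [leRHS]mulrC ler_pdivlMr // -natrM ler_nat mulnC.
  exact: edgesW.
Qed.

End Regularity.

(** Each refinement raises the energy by at least [tau * #|T| ^ 2], while the energy never exceeds
    [#|T| ^ 2]; so the number of refinements is bounded in terms of [g], [h] and [z]. *)
Lemma regularity g h z : 0 < g -> 0 < h -> 0 < z ->
  exists M, forall (T : finType) (G : rel T), exists (K : finType) (p : T -> K),
    #|K| <= M /\ z * #|irregular_pairs G g h p| <= #|T| ^ 2.
Proof.
move=> g0 h0 z0.
pose tau : rat := ((2 * g)%:R ^- 2 / (h ^ 2 * z)%:R)%R.
have tau0 : (0 < tau)%R.
  by rewrite divr_gt0 ?invr_gt0 ?exprn_gt0 ?ltr0n ?muln_gt0 ?expn_gt0 ?h0.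
(* [s] bounds the refinements still possible, [k] the current number of parts. *)
suff claim s k : exists M, forall (T : finType) (G : rel T) (K : finType) (p : T -> K),
    #|K| <= k ->
    ((#|T| ^ 2)%:R <= energy (fun v => (p v.1, p v.2)) (indic G rat)
       + s%:R * tau * (#|T| ^ 2)%:R)%R ->
  exists (K' : finType) (p' : T -> K'),
    #|K'| <= M /\ z * #|irregular_pairs G g h p'| <= #|T| ^ 2.
  have [s s1] : exists s, (1 <= s%:R * tau)%R.
    exists (Num.bound tau^-1); rewrite -ler_pdivrMr // mul1r ltW //.
    by apply: le_lt_trans (archi_boundP _); rewrite ?ler_norm // invr_ge0 ltW.
  have [M MP] := claim s 1; exists M => T G.
  apply: (MP T G unit (fun=> tt)); first by rewrite card_unit.
  by rewrite -[leLHS]add0r lerD ?energy_ge0 // ler_peMl.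
elim: s k => [|s IHs] k.
  exists k => T G K p Kk; rewrite !mul0r addr0 => eT.
  exists K, p; split=> //; rewrite leqNgt; apply/negP => irrT.
  have [p'] := @refine_irregular T G rat g h z K p g0 h0 z0 irrT.
  rewrite -/tau => ep'; have := energy_le (fun v => (p' v.1, p' v.2)) (indic G rat).
  have T0 : (0 < (#|T| ^ 2)%:R :> rat)%R.
    rewrite ltr0n expn_gt0; case: posnP irrT => // T0.
    have /card0_eq := T0 => TE; rewrite eq_card0 ?muln0 // => -[x y].
    by have := TE x.
  have : (\sum_u indic G rat u ^+ 2 <= (#|T| ^ 2)%:R)%R.
    rewrite -mulnn -card_prod -sum1_card natr_sum; apply: ler_sum => u _.
    by rewrite /indic; case: (G _ _); rewrite ?expr1n ?expr0n.
  have := mulr_gt0 tau0 T0; lra.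
(* The new index records two booleans for each of at most [k * k] pairs of parts. *)
have [M MP] := IHs (k * 4 ^ (k * k)).
exists (maxn M k) => T G K p Kk eT.
have [irrT|irrT] := leqP (z * #|irregular_pairs G g h p|) (#|T| ^ 2).
  by exists K, p; rewrite leq_max Kk orbT.
have [p'] := @refine_irregular T G rat g h z K p g0 h0 z0 irrT.
rewrite -/tau => ep'; have [||K' [q [K'M qP]]] := MP T G _ p'.
- rewrite card_prod card_ffun !card_prod card_bool; apply: leq_mul => //.
  by rewrite leq_exp2l // leq_mul.
- by move: eT; rewrite -natr1; lra.
by exists K', q; rewrite leq_max K'M.
Qed.

(** * Greedy embedding into dense parts *)

Lemma card_bigcup_le (I T : finType) (P : pred I) (F : I -> {set T}) :
  #|\bigcup_(i | P i) F i| <= \sum_(i | P i) #|F i|.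
Proof.
elim/big_rec2: _ => [|i n X _ leXn]; first by rewrite cards0.
by rewrite (leq_trans (leq_card_setU _ _)) // leq_add2l.
Qed.

Section Embedding.
Variables (V I T : finType) (E : {set {set V}}) (c : V -> I) (G : rel T).
Variables (A : I -> {set T}) (Qs : {set {set T}}) (g h l : nat).

(** In a linear family and for [x != y], this is the unique member through both points, or empty. *)
Definition line x y : {set T} := \bigcup_(Q in Qs | (x \in Q) && (y \in Q)) Q.

Definition candidates (s : seq V) (phi : V -> T) v : {set T} :=
  [set y in A (c v) | [forall u in s, ([set u; v] \in E) ==> G (phi u) y]].

Hypothesis simpleE : simple_graph E.
Hypothesis c_proper : forall u v, [set u; v] \in E -> c u != c v.
Hypothesis Gsym : symmetric G.
Hypothesis g_gt0 : 0 < g.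
Hypothesis le_h : 2 * #|V| * g ^ #|V| <= h.
Hypothesis card_line : forall x y, x != y -> #|line x y| <= l.
Hypothesis card_A : forall i, 2 * g ^ #|V| * (#|V| + #|V| ^ 2 * l) < #|A i|.
Hypothesis dense_A : forall i j (X Y : {set T}), i != j -> X \subset A i -> Y \subset A j ->
  #|A i| <= h * #|X| -> #|A j| <= h * #|Y| -> #|X| * #|Y| <= g * edges G X Y.

(** A choice for [v] fails if it lies in some [bad w], leaving a later neighbour [w] too few
    candidates, or in [Z]. By [le_h] the bad sets together take at most half of
    [#|A (c v)| / g ^ #|V|], a lower bound for the number of candidates; by [card_A] the set [Z] is
    smaller than the other half. *)
Lemma greedy_step (s : seq V) (phi : V -> T) v :
    uniq (v :: s) ->
    (forall w, w \notin s -> #|A (c w)| <= g ^ size s * #|candidates s phi w|) ->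
  exists x, [/\ x \in candidates s phi v,
    {in s, forall u, phi u != x},
    {in s &, forall u w, phi u != phi w -> x \notin line (phi u) (phi w)} &
    forall w, w \notin v :: s -> [set v; w] \in E ->
      #|candidates s phi w| <= g * #|[set y in candidates s phi w | G x y]| ].
Proof.
set C := candidates s phi => /= /andP[vs us] Cs.
pose bad w := [set x in C v | g * #|[set y in C w | G x y]| < #|C w| ].
pose P w := (w \notin v :: s) && ([set v; w] \in E).
pose Z := [set x in map phi s] :|: \bigcup_(uw : V * V | [&& uw.1 \in s, uw.2 \in s
   & phi uw.1 != phi uw.2]) line (phi uw.1) (phi uw.2).
have CA w : C w \subset A (c w) by apply/subsetP => y; rewrite inE => /andP[].
have sizes : size s <= #|V| by rewrite -(card_uniqP us) max_card.
have gs : g ^ size s <= g ^ #|V| by apply: leq_pexp2l.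
have V0 : 0 < #|V| by apply/card_gt0P; exists v.
have gsh : g ^ size s <= h.
  by apply: leq_trans le_h; apply: leq_trans gs _; rewrite leq_pmull // muln_gt0.
have badP w : P w -> h * #|bad w| <= #|A (c v)|.
  rewrite /P inE negb_or => /andP[/andP[wv ws] vwE].
  (* A large [bad w] would form a dense pair with [C w], yet each of its vertices sees less than a
     [1/g] share of [C w]. *)
  rewrite leqNgt; apply/negP => bigw.
  have badC : bad w \subset C v by apply/subsetP => x; rewrite inE => /andP[].
  have bad0 : 0 < #|bad w| by case: posnP bigw => // ->; rewrite muln0.
  have leC := leq_trans (Cs w ws) (leq_mul gsh (leqnn _)).
  have := dense_A (c_proper vwE) (subset_trans badC (CA v)) (CA w) (ltnW bigw) leC.
  apply/negP; rewrite -ltnNge /edges.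
  have Gy x : \sum_(y in C w) G x y = #|[set y in C w | G x y]|.
    rewrite -sum1_card big_mkcond [RHS]big_mkcond; apply: eq_bigr => y _.
    by rewrite !inE; case: (_ && _); case: (G x y).
  under eq_bigr => x _ do rewrite Gy.
  apply: (@leq_trans (\sum_(x in bad w) (g * #|[set y in C w | G x y]|).+1)).
    by under [leqRHS]eq_bigr => x _ do rewrite -addn1;
      rewrite big_split /= sum1_card -big_distrr -addn1 leq_add2l.
  by rewrite -sum_nat_const; apply: leq_sum => x; rewrite inE => /andP[].
have cardZ : #|Z| <= #|V| + #|V| ^ 2 * l.
  apply: leq_trans (leq_card_setU _ _) _; apply: leq_add.
    by rewrite cardsE (leq_trans (card_size _)) // size_map.
  apply: leq_trans (card_bigcup_le _ _) _.
  apply: (@leq_trans (\sum_(uw : V * V) l)).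
    rewrite big_mkcond; apply: leq_sum => uw _.
    by case: ifP => // /and3P[_ _ /card_line].
  by rewrite sum_nat_const card_prod mulnn.
have : ~~ (C v \subset (\bigcup_(w | P w) bad w) :|: Z).
  apply/negP=> /subset_leq_card /leq_trans/(_ (leq_card_setU _ _)).
  have badU : h * #|\bigcup_(w | P w) bad w| <= #|V| * #|A (c v)|.
    apply: (@leq_trans (\sum_(w : V) #|A (c v)|)); last by rewrite sum_nat_const.
    apply: (leq_trans (leq_mul (leqnn h) (card_bigcup_le _ _))).
    rewrite big_distrr big_mkcond; apply: leq_sum => w _.
    by case: ifP => // /badP.
  move=> CvU.
  have gC : #|A (c v)| <= g ^ #|V| * #|C v|.
    by apply: leq_trans (Cs v vs) _; apply: leq_mul.
  have gU : 2 * g ^ #|V| * #|\bigcup_(w | P w) bad w| <= #|A (c v)|.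
    rewrite -(leq_pmul2l V0) mulnA; apply: leq_trans badU.
    by apply: leq_mul => //; rewrite mulnA [#|V| * 2]mulnC.
  have gZ : 2 * g ^ #|V| * #|Z| < #|A (c v)|.
    by apply: leq_ltn_trans (card_A (c v)); apply: leq_mul.
  have := leq_mul (leqnn (2 * g ^ #|V|)) CvU; lia.
case/subsetPn=> x xC; rewrite !inE !negb_or => /and3P[/bigcupP xbad xs /bigcupP xl].
exists x; split=> // [u us'|u w us' ws nuw|w wP vwE].
- by apply: contraNneq xs => <-; apply: map_f.
- by apply/negP => xuw; apply: xl; exists (u, w); rewrite //= us' ws.
rewrite leqNgt; apply/negP => xw; apply: xbad; exists w; first exact/andP.
by rewrite inE xC.
Qed.

Lemma greedy_embedding (t0 : T) : exists phi : V -> T,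
  [/\ injective phi,
     forall u v, [set u; v] \in E -> G (phi u) (phi v) &
     forall Q, Q \in Qs -> #|[set v | phi v \in Q]| <= 2].
Proof.
(* The fourth invariant drives the induction: each embedded vertex shrinks the candidate sets by a
   factor of at most [g]. *)
suff [phi [phi_inj phiG phiQ _]] : exists phi : V -> T,
  [/\ {in enum V &, injective phi},
     {in enum V &, forall u v, [set u; v] \in E -> G (phi u) (phi v)},
     forall Q, Q \in Qs -> #|[set v in enum V | phi v \in Q]| <= 2 &
     forall w, w \notin enum V ->
       #|A (c w)| <= g ^ size (enum V) * #|candidates (enum V) phi w|].
  exists phi; split=> [u v|u v|Q QQ].
  - by apply: phi_inj; rewrite mem_enum.
  - by apply: phiG; rewrite mem_enum.
  - apply: leq_trans (phiQ Q QQ); apply/subset_leq_card/subsetP => v.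
    by rewrite !inE mem_enum.
elim: (enum V) (enum_uniq V) => [_|v s IHs uvs].
  exists (fun=> t0); split=> // [Q QQ|w _].
    by rewrite (eq_card0 (fun v => _)) // => v; rewrite !inE.
  rewrite expn0 mul1n; apply/subset_leq_card/subsetP => y yA.
  by rewrite inE yA; apply/forall_inP => u; rewrite in_nil.
have /andP[vs us] := uvs.
have [phi [phi_inj phiG phiQ phiC]] := IHs us.
have [x [xC xphi xl xG]] := greedy_step uvs phiC.
pose psi u := if u == v then x else phi u.
have psiv : psi v = x by rewrite /psi eqxx.
have psis u : u \in s -> psi u = phi u.
  by rewrite /psi; case: eqP => // ->; rewrite (negbTE vs).
have xGs u : u \in s -> [set u; v] \in E -> G (phi u) x.
  by move: xC; rewrite inE => /andP[_ /forall_inP xC] /xC/implyP.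
exists psi; split=> [u w|u w|Q QQ|w wvs].
- rewrite !inE => /predU1P[->|us'] /predU1P[->|ws] //; rewrite ?psiv ?psis //.
  + by move=> /esym/eqP; rewrite (negbTE (xphi _ ws)).
  + by move=> /eqP; rewrite (negbTE (xphi _ us')).
  + exact: phi_inj.
- rewrite !inE => /predU1P[->|us'] /predU1P[->|ws]; rewrite ?psiv ?psis //.
  + by move=> /simpleE; rewrite cards2 eqxx.
  + by rewrite setUC Gsym; apply: xGs.
  + exact: xGs.
  + exact: phiG.
- have [xQ|xQ] := boolP (x \in Q); last first.
    apply: leq_trans (phiQ Q QQ); apply/subset_leq_card/subsetP => u.
    rewrite !inE => /andP[/predU1P[->|us'] ]; first by rewrite psiv (negbTE xQ).
    by rewrite psis // us'.
  (* Two earlier images in [Q] would put [x] on their [line]. *)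
  have le1 : #|[set u in s | phi u \in Q]| <= 1.
    rewrite leqNgt; apply/negP => /card_gt1P[u [w [uP wP nuw]]].
    move: uP wP; rewrite !inE => /andP[us' uQ] /andP[ws wQ].
    have /negP := xl u w us' ws (contra_neq (phi_inj u w us' ws) nuw).
    by apply; apply/bigcupP; exists Q; rewrite // QQ uQ.
  apply: (@leq_trans #|v |: [set u in s | phi u \in Q]|).
    apply/subset_leq_card/subsetP => u.
    rewrite !inE => /andP[/predU1P[->|us'] uQ]; first by rewrite eqxx.
    by rewrite -psis // us' uQ orbT.
  by rewrite cardsU1 (leq_add (leq_b1 _) le1).
- move: (wvs); rewrite inE negb_or => /andP[wv ws].
  have [vwE|vwE] := boolP ([set v; w] \in E).
    apply: (leq_trans (phiC w ws)).
    rewrite /= expnSr -mulnA leq_mul2l; apply/orP; right.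
    apply: (leq_trans (xG w wvs vwE)); rewrite leq_mul2l; apply/orP; right.
    apply/subset_leq_card/subsetP => y; rewrite !inE => /andP[/andP[-> /forall_inP yG] xy].
    apply/forall_inP => u; rewrite inE => /predU1P[->|us']; first by rewrite psiv xy implybT.
    by rewrite psis // yG.
  apply: (leq_trans (phiC w ws)); apply: leq_mul; first by rewrite leq_pexp2l.
  apply/subset_leq_card/subsetP => y; rewrite !inE => /andP[-> /forall_inP yG].
  apply/forall_inP => u; rewrite inE => /predU1P[->|us']; first by rewrite (negbTE vwE).
  by rewrite psis // yG.
Qed.

End Embedding.

(** * Cleaning: sparse pairs and small parts *)

Section Cleaning.
Variables (T K : finType) (G : rel T) (p : T -> K).

Definition sparse_pairs g : {set T * T} :=
  [set xy | G xy.1 xy.2 && (g * edges G (part p (p xy.1)) (part p (p xy.2))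
     < #|part p (p xy.1)| * #|part p (p xy.2)|)].

(** In each sparse pair of parts the edges are less than a [1/g] share of the vertex pairs, and
    these cells are disjoint. *)
Lemma card_sparse_pairs g : g * #|sparse_pairs g| <= #|T| ^ 2.
Proof.
pose D a b := g * edges G (part p a) (part p b) < #|part p a| * #|part p b|.
have sumD F := @sum_over_cells T K p D (fun a b => part p a) (fun a b => part p b) F
  (fun _ _ _ => subxx _) (fun _ _ _ => subxx _).
have -> : #|sparse_pairs g| = \sum_(u : T * T | [&& D (p u.1) (p u.2),
    u.1 \in part p (p u.1) & u.2 \in part p (p u.2)]) G u.1 u.2.
  rewrite -sum1_card big_mkcond [RHS]big_mkcond; apply: eq_bigr => u _.
  by rewrite !inE !eqxx !andbT -/(D _ _); case: (D _ _); case: (G _ _).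
rewrite sumD big_distrr /=.
apply: (@leq_trans (\sum_(ab | D ab.1 ab.2) #|part p ab.1| * #|part p ab.2|)).
  by apply: leq_sum => ab /ltnW.
rewrite -mulnn -card_prod -sum1_card.
under eq_bigr => ab _ do rewrite -sum_nat_const.
under eq_bigr => ab _ do under eq_bigr => x _ do rewrite -sum1_card.
by rewrite -(sumD (fun=> 1)) big_mkcond; apply: leq_sum => u _; case: ifP.
Qed.

Definition in_small_part s : {set T} := [set x | #|part p (p x)| * s < #|T|].

Lemma card_in_small_part s : #|in_small_part s| * s <= #|K| * #|T|.
Proof.
rewrite -sum1_card (partition_big p predT) //= big_distrl -sum_nat_const /=.
apply: leq_sum => a _; have [x xP|P0] := pickP (fun x => (x \in in_small_part s) && (p x == a)).
  case/andP: xP; rewrite inE => /ltnW xs /eqP <-; apply: leq_trans xs.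
  rewrite leq_mul2r sum1_card; apply/orP; right; apply/subset_leq_card/subsetP => y.
  by rewrite !inE => /andP[].
by rewrite big_pred0.
Qed.

End Cleaning.

(** * Embedding into a large linear family of cliques *)

Section LinearFamily.
Variables (V : finType) (E : {set {set V}}) (k z : nat) (c : V -> 'I_k).
Hypothesis simpleE : simple_graph E.
Hypothesis c_proper : forall u v, [set u; v] \in E -> c u != c v.
Hypothesis k_gt1 : 1 < k.

Definition linear_family (T : finType) (Qs : {set {set T}}) : Prop :=
  forall Q Q' x y, Q \in Qs -> Q' \in Qs -> x != y ->
    x \in Q -> y \in Q -> x \in Q' -> y \in Q' -> Q = Q'.

(** Each of the three kinds of bad pairs numbers at most [#|T| ^ 2 / (3 * z)], so there are fewer
    bad pairs than cliques. As a pair lies in at most one clique, some clique has no bad pair, and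
    the parts of its vertices receive the embedding. *)
Lemma linear_family_embedding : exists n0, forall (T : finType) (Qs : {set {set T}}),
    n0 <= #|T| -> #|T| ^ 2 < z * #|Qs| ->
    (forall Q, Q \in Qs -> #|Q| = k) -> linear_family Qs ->
  exists phi : V -> T, [/\ injective phi,
    forall u v, [set u; v] \in E ->
      exists2 Q, Q \in Qs & (phi u \in Q) && (phi v \in Q) &
    forall Q, Q \in Qs -> #|[set v | phi v \in Q]| <= 2].
Proof.
case: (posnP z) => [->|z0]; first by exists 0.
(* [g] is twice [g0] because regularity keeps only half of the density; the successor keeps [h]
   positive for empty [V]. *)
pose g0 := 3 * z; pose g := 2 * g0; pose h := (2 * #|V| * g ^ #|V|).+1.
have g00 : 0 < g0 by rewrite muln_gt0.
have [M MP] := @regularity g0 h (3 * z) g00 isT g00.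
(* Parts below [#|T| / s] cover at most a [1/(3z)] share of the vertices, and the bound on [#|T|]
   gives every other part more than [L] vertices. *)
pose s := 3 * z * M.+1; pose L := 2 * g ^ #|V| * (#|V| + #|V| ^ 2 * k).
exists (L.+1 * s) => T Qs leT ltQ Qk Qlin.
pose G x y := (x != y) && [exists Q in Qs, (x \in Q) && (y \in Q)].
have [K [p [KM irrT]]] := MP T G.
have T0 : 0 < #|T| by apply: leq_trans leT; rewrite /s !muln_gt0 z0.
pose Small := setX (in_small_part p s) [set: T].
have smallT : 3 * z * #|Small| <= #|T| ^ 2.
  rewrite cardsX cardsT -mulnn mulnA leq_mul2r; apply/orP; right.
  have := card_in_small_part p s; rewrite /s => le.
  rewrite -(@leq_pmul2r M.+1) //; apply: leq_trans (leq_trans le _); first by lia.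
  by rewrite mulnC leq_mul2l (leq_trans KM) // orbT.
pose Bad := irregular_pairs G g0 h p :|: sparse_pairs G p g0 :|: Small.
have badT : z * #|Bad| <= #|T| ^ 2.
  have leB : #|Bad| <= #|irregular_pairs G g0 h p| + #|sparse_pairs G p g0| + #|Small|.
    by apply: leq_trans (leq_card_setU _ _) _; rewrite leq_add2r leq_card_setU.
  have spT : 3 * z * #|sparse_pairs G p g0| <= #|T| ^ 2 by apply: card_sparse_pairs.
  by move: (leq_mul (leqnn z) leB) irrT spT smallT; clearbody Bad Small g0 h; lia.
have [t0 _] := card_gt0P T0.
have [Q QQs Qgood] : exists2 Q, Q \in Qs &
    {in Q &, forall x y, x != y -> (x, y) \notin Bad}.
  have [/exists_inP[Q QQs /forall_inP Qgood]|/exists_inPn noQ] :=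
    boolP [exists Q in Qs, [forall x in Q, [forall y in Q, (x != y) ==> ((x, y) \notin Bad)]]].
    by exists Q => // x y /Qgood /forall_inP yQ /yQ/implyP.
  pose ok (Q : {set T}) xy :=
    [&& xy.1 \in Q, xy.2 \in Q, xy.1 != xy.2 & xy \in Bad].
  have okP Q : Q \in Qs -> exists xy, ok Q xy.
    move=> /noQ /forall_inPn[x xQ /forall_inPn[y yQ]].
    by rewrite negb_imply negbK => /andP[xy xyB]; exists (x, y); apply/and4P.
  (* If every clique had a bad pair, charging it to one would be injective by linearity. The default
     is never reached on [Qs]. *)
  pose beta Q := odflt (t0, t0) [pick xy | ok Q xy].
  have betaP Q : Q \in Qs -> ok Q (beta Q).
    by move=> /okP[xy xyQ]; rewrite /beta; case: pickP => // /(_ xy); rewrite xyQ.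
  have beta_inj : {in Qs &, injective beta}.
    move=> Q Q' QQs Q'Qs eqb; have /and4P[b1 b2 b12 _] := betaP Q QQs.
    have := betaP Q' Q'Qs; rewrite -eqb => /and4P[b1' b2' _ _].
    exact: Qlin b12 b1 b2 b1' b2'.
  have : #|Qs| <= #|Bad|.
    rewrite -(card_in_imset beta_inj); apply/subset_leq_card/subsetP => _ /imsetP[Q QQs ->].
    by have /and4P[] := betaP Q QQs.
  by move=> /(leq_mul (leqnn z)) /(leq_trans ltQ) /leq_trans/(_ badT); rewrite ltnn.
(* Colours index the vertices of [Q]; colour class [i] goes into the part of [q i]. *)
pose q (i : 'I_k) := nth t0 (enum Q) i.
have sizeQ : size (enum Q) = k by rewrite -cardE Qk.
have qQ i : q i \in Q by rewrite -mem_enum mem_nth ?sizeQ.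
have q_neq i j : i != j -> q i != q j.
  by apply: contra_neq => /eqP; rewrite nth_uniq ?enum_uniq ?sizeQ // => /eqP/val_inj.
have Qpair i j : i != j -> (q i, q j) \notin Bad.
  by move=> ij; apply: Qgood => //; apply: q_neq.
pose A i := part p (p (q i)).
have k0 : 0 < k by apply: ltnW.
have [||||||phi [phi_inj phiG phiQ]] :=
  @greedy_embedding V 'I_k T E c G A Qs g h k simpleE c_proper _ _ _ _ _ _ t0.
- move=> x y; rewrite /G eq_sym; congr (_ && _).
  by apply: eq_existsb => Q'; rewrite [(y \in Q') && _]andbC.
- by rewrite !muln_gt0 z0.
- exact: leqnSn.
- move=> x y xy; have [Q' /and3P[Q'Qs xQ' yQ']|noQ] :=
    pickP (fun Q' => [&& Q' \in Qs, x \in Q' & y \in Q']); last first.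
    by rewrite /line big_pred0 ?cards0.
  rewrite -(Qk Q' Q'Qs); apply/subset_leq_card/bigcupsP => Q'' /and3P[Q''Qs xQ'' yQ''].
  by rewrite (Qlin _ _ _ _ Q'Qs Q''Qs xy xQ' yQ' xQ'' yQ'').
- move=> i.
  have [j ij] : exists j : 'I_k, i != j.
    case: (eqVneq i (Ordinal k0)) => [->|]; last by exists (Ordinal k0).
    by exists (Ordinal k_gt1).
  have := Qpair i j ij; rewrite !inE !negb_or andbT -leqNgt => /andP[_ /=].
  rewrite -/(A i) -/L => le; have := leq_trans leT le.
  by rewrite leq_pmul2r // /s muln_gt0 g00.
- move=> i j X Y ij XA YA lX lY.
  have := Qpair i j ij; rewrite !inE !negb_or andbT -!leqNgt /=.
  (* This edge is not sparse, so its parts have density at least [1/g0]; not being irregular, they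
     leave half of it to [X] and [Y]. *)
  have -> : G (q i) (q j).
    by rewrite /G q_neq //=; apply/exists_inP; exists Q; rewrite ?qQ.
  rewrite -leqNgt -!/(A _) => /andP[/andP[irr dense] _].
  move: irr; rewrite /irregular dense /= => /existsPn/(_ X)/existsPn/(_ Y).
  by rewrite XA YA lX lY /= -leqNgt.
exists phi; split=> // u v /phiG /andP[_ /exists_inP[Q' Q'Qs uvQ']].
by exists Q'.
Qed.

End LinearFamily.

(** * Berge copies, codegrees and thin cliques *)

Section Berge.
Variables (V : finType) (E : {set {set V}}) (n : nat) (H : {set {set 'I_n}}).

Definition codegree (S : {set 'I_n}) : nat := #|[set h in H | S \subset h]|.

Lemma contains_bergeI (phi : V -> 'I_n) (f : {set V} -> {set 'I_n}) :
    injective phi ->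
    {in E, forall d, f d \in H /\ phi @: d \subset f d} ->
    {in E &, injective f} ->
  contains_berge E H.
Proof.
move=> phi_inj fH f_inj; apply/existsP; exists (finfun phi).
apply/andP; split; first by apply/injectiveP => u v; rewrite !ffunE => /phi_inj.
apply/existsP; exists (finfun f); apply/andP; split.
  apply/forall_inP => d /fH[fdH sub]; rewrite ffunE fdH /=.
  by rewrite (eq_imset _ (ffunE phi)).
apply/forall_inP => d1 d1E; apply/forall_inP => d2 d2E.
by rewrite !ffunE; apply/implyP => /eqP/(f_inj _ _ d1E d2E)->.
Qed.

(** [h] represents [e]. Every other edge lies in at least [#|E| - 1] hyperedges besides [h], enough
    for distinct representatives. *)
Lemma berge_of_fat_pairs (phi : V -> 'I_n) e h :
    e \in E -> h \in H -> injective phi -> (forall v, phi v \in h) ->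
    {in E :\ e, forall d : {set V}, #|E| <= codegree (phi @: d)} ->
  contains_berge E H.
Proof.
move=> eE hH phi_inj phih fat.
have sub_h (d : {set V}) : phi @: d \subset h by apply/subsetP => _ /imsetP[v _ ->].
have [|f [fC f_inj]] := @distinct_representatives _ _ h (enum (E :\ e))
    (fun d => [set h' in H | phi @: d \subset h'] :\ h).
  move=> d; rewrite mem_enum => dE; rewrite -cardE.
  have := fat d dE; rewrite /codegree (cardsD1 h) (cardsD1 e E) eE inE hH sub_h.
  by rewrite !add1n ltnS.
have {}fC d : d \in E -> d != e -> [/\ f d != h, f d \in H & phi @: d \subset f d].
  by move=> dE de; have := fC d; rewrite mem_enum !inE de dE => /(_ isT)/and3P[].
have {}f_inj d1 d2 : d1 \in E -> d1 != e -> d2 \in E -> d2 != e -> f d1 = f d2 -> d1 = d2.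
  by move=> E1 e1 E2 e2; apply: f_inj; rewrite mem_enum !inE ?e1 ?e2.
apply: (@contains_bergeI phi (fun d => if d == e then h else f d)) => // [d dE|d1 d2 E1 E2].
  by case: eqP => [_|/eqP de] //; have [] := fC d dE de.
case: eqP => [->|/eqP e1]; case: eqP => [->|/eqP e2] //.
- by have [/eqP + _ _ /esym] := fC d2 E2 e2.
- by have [/eqP] := fC d1 E1 e1.
exact: f_inj.
Qed.

(** The hyperedge chosen for [d] determines [d]: the at most two embedded vertices in its clique are
    the ends of [d]. *)
Lemma berge_of_linear_family (phi : V -> 'I_n) (Q : {set 'I_n} -> {set 'I_n})
    (H' : {set {set 'I_n}}) :
    simple_graph E -> injective phi ->
    {in H', forall h, h \in H /\ Q h \subset h} ->
    {in E, forall d : {set V}, exists2 h, h \in H' & phi @: d \subset Q h} ->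
    {in H', forall h, #|[set v | phi v \in Q h]| <= 2} ->
  contains_berge E H.
Proof.
move=> simpleE phi_inj H'H EQ Q2.
pose f (d : {set V}) := odflt set0 [pick h in H' | phi @: d \subset Q h].
have fP d : d \in E -> f d \in H' /\ phi @: d \subset Q (f d).
  move=> /EQ[h hH' dh]; rewrite /f; case: pickP => [h' /andP[] //|/(_ h)].
  by rewrite hH' dh.
have fE d : d \in E -> d = [set v | phi v \in Q (f d)].
  move=> dE; have [fH' dQ] := fP d dE; apply/eqP.
  rewrite eqEcard (simpleE d dE) Q2 // andbT; apply/subsetP => v vd.
  by rewrite inE (subsetP dQ) // imset_f.
apply: (contains_bergeI phi_inj (f := f)) => [d dE|d1 d2 E1 E2 f12].
  have [fH' dQ] := fP d dE; have [fH Qf] := H'H _ fH'.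
  by split=> //; apply: subset_trans Qf.
by rewrite [LHS](fE d1 E1) f12 -(fE d2 E2).
Qed.

(** The Ramsey property is applied to [N] vertices of [h], with pairs of codegree at least [#|E|]
    red. A red copy would yield a Berge copy, so there is a blue clique. *)
Lemma thin_clique k e N h :
    ramsey_property k (E :\ e) N -> ~~ contains_berge E H ->
    e \in E -> h \in H -> N <= #|h| ->
  exists Q : {set 'I_n}, [/\ Q \subset h, #|Q| = k &
    {in Q &, forall x y, x != y -> codegree [set x; y] < #|E|} ].
Proof.
move=> ramsey noB eE hH Nh.
pose iota (i : 'I_N) := enum_val (widen_ord Nh i).
have iota_inj : injective iota.
  by move=> i j /enum_val_inj/(congr1 val) ij; apply: val_inj.
have iotah i : iota i \in h by apply: enum_valP.
have [[psi [psi_inj psiB]]|[psi [psi_inj psiR]]] :=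
  ramsey (fun S => #|E| <= codegree (iota @: S)).
  exists [set iota (psi i) | i : 'I_k]; split.
  - by apply/subsetP => _ /imsetP[i _ ->].
  - by rewrite card_imset ?card_ord //; apply: inj_comp.
  move=> _ _ /imsetP[i _ ->] /imsetP[j _ ->] ij.
  have /psiB/negbT : i != j by apply: contra_neq ij => ->.
  by rewrite -ltnNge imsetU1 imset_set1.
case/negP: noB; apply: (@berge_of_fat_pairs (iota \o psi) e h) => // [|v|d /psiR].
- exact: inj_comp.
- exact: iotah.
by rewrite (imset_comp iota psi).
Qed.

(* A maximal family of members whose cliques pairwise share at most one vertex:
   every member contains a pair lying in one of the chosen cliques. *)
Lemma linear_subfamily k m (Q : {set 'I_n} -> {set 'I_n}) : 1 < k ->
    {in H, forall h, [/\ Q h \subset h, #|Q h| = k &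
      {in Q h &, forall x y, x != y -> codegree [set x; y] < m} ]} ->
  exists H' : {set {set 'I_n}}, [/\ H' \subset H,
    {in H' &, forall a b, a != b -> #|Q a :&: Q b| <= 1} &
    #|H| <= k ^ 2 * m * #|H'| ].
Proof.
move=> k1 HQ.
pose P (S : {set {set 'I_n}}) := (S \subset H) &&
  [forall a in S, forall b in S, (a != b) ==> (#|Q a :&: Q b| <= 1)].
have P0 : P set0 by rewrite /P sub0set; apply/forall_inP => a; rewrite inE.
have [H' /maxsetP[/andP[H'H /forall_inP H'lin] H'max] _] := maxset_exists P0.
exists H'; split=> // [a b aH' bH' ab|].
  by have /forall_inP/(_ b bH')/implyP := H'lin a aH'; apply.
(* Each chosen clique has at most [k ^ 2] ordered pairs, each of codegree below [m]. *)
pose U := \bigcup_(a in H') \bigcup_(xy in [set xy in setX (Q a) (Q a) | xy.1 != xy.2])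
  [set h in H | [set xy.1; xy.2] \subset h].
have HU : H \subset U.
  apply/subsetP => h hH; have [Qh Qk _] := HQ h hH.
  suff [a aH' share] : exists2 a, a \in H' & 1 < #|Q h :&: Q a|.
    have [x [y []]] := card_gt1P share; rewrite !inE => /andP[xh xa] /andP[yh ya] xy.
    apply/bigcupP; exists a => //; apply/bigcupP; exists (x, y).
      by rewrite !inE /= xa ya.
    by rewrite inE hH subUset !sub1set !(subsetP Qh).
  have [hH'|hH'] := boolP (h \in H'); first by exists h; rewrite // setIid Qk.
  (* If [Q h] met every chosen clique in at most one vertex, [h] could be added to [H'], against
     maximality. *)
  apply/exists_inP; rewrite -[X in is_true X]negbK; apply: contra hH'.
  move=> /exists_inPn lin; rewrite -(H'max (h |: H')) ?setU11 ?subsetUr //.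
  have {}lin a : a \in H' -> #|Q h :&: Q a| <= 1 by move=> /lin; rewrite -leqNgt.
  rewrite /P subUset sub1set hH H'H; apply/forall_inP => a aP.
  apply/forall_inP => b bP; apply/implyP => ab.
  case/setU1P: aP ab => [->|aH']; case/setU1P: bP => [->|bH'] ab.
  - by rewrite eqxx in ab.
  - exact: lin.
  - by rewrite setIC; apply: lin.
  by have /forall_inP/(_ b bH')/implyP := H'lin a aH'; apply.
apply: leq_trans (subset_leq_card HU) (leq_trans (card_bigcup_le _ _) _).
rewrite mulnC -sum_nat_const; apply: leq_sum => a aH'.
have [_ Qk Qm] := HQ a (subsetP H'H a aH').
apply: leq_trans (card_bigcup_le _ _) _.
apply: (@leq_trans (\sum_(xy in setX (Q a) (Q a)) m)).
  rewrite big_mkcond [leqRHS]big_mkcond; apply: leq_sum => -[x y] _ /=.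
  rewrite in_set; case: ifP => //; rewrite in_setX /= => /andP[/andP[xa ya] xy].
  by rewrite xa ya; apply: ltnW; apply: Qm.
by rewrite sum_nat_const cardsX Qk mulnn.
Qed.

End Berge.

(** * The bound on the uniformity threshold *)

Lemma chromatic_colouring (V : finType) (E : {set {set V}}) : simple_graph E ->
  exists c : V -> 'I_(chromatic_number E),
    forall u v, [set u; v] \in E -> c u != c v.
Proof.
move=> simpleE; rewrite /chromatic_number; case: ex_minnP => k /existsP[c cP] _.
exists c => u v uvE; have uv : u != v.
  by have := simpleE _ uvE; rewrite cards2; case: eqP.
have /forall_inP/(_ u (set21 _ _))/forall_inP/(_ v (set22 _ _)) :=
  forall_inP cP _ uvE.
by rewrite uv.
Qed.

Theorem theorem4 (V : finType) (E : {set {set V}}) (e : {set V}) (N : nat) :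
  simple_graph E -> e \in E ->
  is_ramsey_number (chromatic_number E) (E :\ e) N ->
  threshold_admissible E N.
Proof.
move=> simpleE eE [ramsey _] r Nr k0 k00.
have [c c_proper] := chromatic_colouring simpleE.
set k := chromatic_number E in c c_proper ramsey.
have k1 : 1 < k.
  have /eqP/cards2P[u [v [_ eE2]]] := simpleE e eE.
  have := c_proper u v; rewrite -eE2 => /(_ eE).
  case: (c u) (c v) => [i ik] [j jk]; rewrite -val_eqE /= => ij; lia.
(* More than [n ^ 2 / k0] hyperedges are assumed below, and the linear subfamily keeps a
   [1/(k ^ 2 * #|E|)] share of them. *)
have [n0 embed] := linear_family_embedding (k0 * (k ^ 2 * #|E|)) simpleE c_proper k1.
exists n0 => n n0n.
rewrite mulnC -leq_divRL //; apply/bigmax_leqP => H /andP[/forall_inP Hr noB].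
rewrite leq_divRL // mulnC leqNgt; apply/negP => ltH.
have /fin_all_exists[Q QP] (h : {set 'I_n}) : exists Q : {set 'I_n}, h \in H ->
    [/\ Q \subset h, #|Q| = k &
      {in Q &, forall x y, x != y -> codegree H [set x; y] < #|E|} ].
  have [hH|] := boolP (h \in H); last by exists set0.
  have [|Q QP] := thin_clique ramsey noB eE hH; last by exists Q.
  by rewrite (eqP (Hr h hH)).
have [H' [H'H H'lin cardH]] := linear_subfamily k1 QP.
(* Equal cliques would share [k > 1] vertices; hence there are as many cliques as members of
   [H']. *)
have Q_inj : {in H' &, injective Q}.
  move=> a b aH' bH' Qab; apply/eqP/negPn/negP => /(H'lin a b aH' bH').
  by rewrite Qab setIid; have [_ -> _] := QP b (subsetP H'H b bH'); rewrite leqNgt k1.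
have [| | | |phi [phi_inj phiE phiQ]] := embed 'I_n (Q @: H').
- by rewrite card_ord.
- rewrite card_ord card_in_imset //; apply: leq_trans ltH _.
  by rewrite -mulnA leq_mul2l cardH orbT.
- by move=> _ /imsetP[a aH' ->]; have [] := QP a (subsetP H'H a aH').
- move=> _ _ x y /imsetP[a aH' ->] /imsetP[b bH' ->] xy xa ya xb yb.
  have [-> //|/(H'lin a b aH' bH')] := eqVneq a b.
  rewrite leqNgt => /negP[]; apply/card_gt1P.
  by exists x, y; split; rewrite // inE ?xa ?ya.
case/negP: noB; apply: (berge_of_linear_family simpleE phi_inj (Q := Q) (H' := H')).
- by move=> h hH'; have hH := subsetP H'H h hH'; have [] := QP h hH.
- move=> d dE; have /eqP/cards2P[u [v [_ dE2]]] := simpleE d dE.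
  have := phiE u v; rewrite -dE2 => /(_ dE)[_ /imsetP[h hH' ->] /andP[uh vh]].
  by exists h; rewrite // dE2 imsetU1 imset_set1 subUset !sub1set uh.
by move=> h hH'; apply: phiQ; apply: imset_f.
Qed.
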